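(* Let $n\ge 4$ be an integer and let $\Lambda_n$ denote the Lebesgue constant of Lagrange interpolation by polynomials of total degree at most $n$ at the equally spaced nodes of a triangle. Then $$\Lambda_n\le \Big(7+\mu_n\Big)\,\frac{2^{n+1}}{e\,n(\ln n-\ln 2)}\Big(1+\frac{15}{n-3}\Big),\qquad\text{where}\qquad \mu_n\le \frac{3e\,n(\ln n)^3}{2^{n/3}}+\frac{e\,n^2\ln n}{2^n}.$$ In particular $\mu_n\to 0$ as $n\to\infty$.
   Context: Let $\Delta\subset\mathbb{R}^2$ be a non-degenerate triangle; points of $\Delta$ are identified with their barycentric coordinates $\lambda=(\lambda_1,\lambda_2,\lambda_3)$, $\lambda_r\ge 0$, $\lambda_1+\lambda_2+\lambda_3=1$. For an integer $n\ge1$ let $I=\{i=(i_1,i_2,i_3)\in\mathbb{Z}_+^3: i_1+i_2+i_3=n\}$ and let the nodes be $a_i=(i_1/n,i_2/n,i_3/n)$, $i\in I$. The Lagrange fundamental polynomials $l_i$, $i\in I$, are the polynomials of total degree $\le n$ with $l_i(a_j)=\delta_{ij}$; explicitly $l_i(\lambda)=\prod_{s=1}^{3}\frac{1}{i_s!}\prod_{t=0}^{i_s-1}(n\lambda_s-t)$. The Lebesgue function is $\mathcal{L}_n(\lambda)=\sum_{i\in I}|l_i(\lambda)|$ and the Lebesgue constant is $\Lambda_n=\max_{\lambda\in\Delta}\mathcal{L}_n(\lambda)$, which equals the operator norm on $C(\Delta)$ of the map $f\mapsto \sum_{i\in I}f(a_i)l_i$. *)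

(* Defs.v *)
From HB Require Import structures.
From mathcomp Require Import all_boot all_order all_algebra.
From mathcomp Require Import all_classical all_reals all_analysis.
Set Implicit Arguments. Unset Strict Implicit. Unset Printing Implicit Defensive.
Import Order.TTheory GRing.Theory Num.Theory.
Local Open Scope classical_set_scope.
Local Open Scope ring_scope.

(* Points of the triangle in barycentric coordinates (l1, l2, l3). *)
Definition simplex {R : realType} : set (R * R * R) :=
  [set l | 0 <= l.1.1 /\ 0 <= l.1.2 /\ 0 <= l.2 /\ l.1.1 + l.1.2 + l.2 = 1].

Definition lfactor (R : realType) (n k : nat) (x : R) : R :=
  (k`!%:R)^-1 * \prod_(t < k) (n%:R * x - t%:R).

(* Lagrange fundamental polynomial l_i, i = (i1,i2,i3), i1+i2+i3 = n *)
Definition lagr (R : realType) (n i1 i2 i3 : nat) (l : R * R * R) : R :=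
  lfactor n i1 l.1.1 * lfactor n i2 l.1.2 * lfactor n i3 l.2.

Definition lebesgue_fun (R : realType) (n : nat) (l : R * R * R) : R :=
  \sum_(i1 < n.+1) \sum_(i2 < (n - i1).+1) `| lagr n i1 i2 (n - i1 - i2) l |.

Definition lebesgue_const (R : realType) (n : nat) : R :=
  sup [set lebesgue_fun n l | l in @simplex R].

Definition mu_bound (R : realType) (n : nat) : R :=
  3 * expR 1 * n%:R * (ln n%:R) ^+ 3 / ((2 : R) `^ (n%:R / 3))
  + expR 1 * n%:R ^+ 2 * ln n%:R / 2 ^+ n.

(* Main.v *)
Require Import Defs.
From HB Require Import structures.
From mathcomp Require Import all_boot all_order all_algebra.
From mathcomp Require Import all_classical all_reals all_analysis.
From mathcomp Require Import ring lra zify.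
Set Implicit Arguments. Unset Strict Implicit. Unset Printing Implicit Defensive.
Import Order.TTheory GRing.Theory Num.Theory.
Import numFieldNormedType.Exports.
Local Open Scope classical_set_scope.
Local Open Scope ring_scope.

(** Put [x = n l1], [y = n l2], [z = n l3]. The Lebesgue function is the
    coefficient of [t^n] in [A_x A_y A_z], where [A_x(t) = sum_k |C(x,k)| t^k].
    Write [x = p + u] with [p] a natural number and [u] in [0, 1]; Vandermonde's
    identity bounds [A_x] coefficientwise by [(1 + t)^p A_u], and
    [A_u = 2 - (1 - t)^u]. Hence the Lebesgue function is at most the coefficient
    of [t^n] in [(1 + t)^N c(t)] with
    [c = (2 - (1-t)^u) (2 - (1-t)^v) (2 - (1-t)^w)], where [u + v + w] can be
    taken to be 1 or 2 and [N = n - (u + v + w)]. If [u + v + w = 1], expanding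
    the product leaves [s c_s <= 4 (b_s(u) + b_s(v) + b_s(w))] for [s >= 2], with
    [b_s(u) = u prod_(0 < t < s) (1 - u/t) <= min (u (1 - u), 1 / (e ln s))], and
    [n C(n-1, n-s) = s C(n, s)] turns the coefficient into
    [(2^n / n) E(s c_s)] for [s] binomial with parameters [n], [1/2]. The case
    [u + v + w = 2] is similar and gains a factor of nearly 2.
    For [n <= 34] the bound [4 sum b_s <= 8/3] suffices. For [n >= 35] the range
    [s >= n/3] contributes at most [12 / (e ln (n/3)) <= 14 / (e ln (n/2))],
    because [(n/2)^6 <= (n/3)^7], and the range [s < n/3] is exponentially
    small, so that it fits in the factor [1 + 15/(n-3)]. *)

(** * Cauchy products *)

Definition convol {R : realType} (f g : nat -> R) (n : nat) : R :=
  \sum_(i < n.+1) f i * g (n - i)%N.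

(** Truncation to polynomials of size above [n] loses nothing up to degree [n], so commutativity and
    associativity are inherited from the polynomial ring. *)
Lemma convol_coef {R : realType} (f g : nat -> R) (N n : nat) : (n < N)%N ->
  convol f g n = ((\poly_(i < N) f i) * (\poly_(i < N) g i))`_n.
Proof.
move=> nN; rewrite coefM; apply: eq_bigr => i _; rewrite !coef_poly.
have := ltn_ord i => lti.
by rewrite !ifT //; lia.
Qed.

Lemma eq_convol {R : realType} (f f' g g' : nat -> R) (n : nat) :
  f =1 f' -> g =1 g' -> convol f g n = convol f' g' n.
Proof. by move=> ff gg; apply: eq_bigr => i _; rewrite ff gg. Qed.

Lemma convolC {R : realType} (f g : nat -> R) (n : nat) : convol f g n = convol g f n.
Proof. by rewrite !(@convol_coef _ _ _ n.+1 n) // mulrC. Qed.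

Lemma convolA {R : realType} (f g h : nat -> R) (n : nat) :
  convol f (convol g h) n = convol (convol f g) h n.
Proof.
set P := fun u : nat -> R => \poly_(i < n.+1) u i.
have E (u v : nat -> R) i : (i <= n)%N -> convol u v i = (P u * P v)`_i.
  by move=> lei; apply: convol_coef.
transitivity ((P f * (P g * P h))`_n).
  rewrite coefM; apply: eq_bigr => i _; rewrite E ?leq_subr //.
  by rewrite coef_poly ltn_ord.
rewrite mulrA coefM; apply: eq_bigr => i _; rewrite E ?leq_ord //.
by rewrite coef_poly ifT //; lia.
Qed.

Lemma convol_ge0 {R : realType} (f g : nat -> R) (n : nat) :
  (forall i, 0 <= f i) -> (forall i, 0 <= g i) -> 0 <= convol f g n.
Proof. by move=> f0 g0; apply: sumr_ge0 => i _; apply: mulr_ge0. Qed.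

Lemma ler_convol {R : realType} (f f' g g' : nat -> R) (n : nat) :
  (forall i, 0 <= f i <= f' i) -> (forall i, 0 <= g i <= g' i) ->
  convol f g n <= convol f' g' n.
Proof.
move=> ff gg; apply: ler_sum => i _.
have /andP[f0 f1] := ff i; have /andP[g0 g1] := gg (n - i)%N.
exact: ler_pM.
Qed.

(** The sequence [k == 0] is the unit of the product; the shape [c * unit - f] is the one that
    [gbin_abs] produces. *)
Lemma convol_deltaB {R : realType} (c : R) (f g : nat -> R) (n : nat) :
  convol (fun k => c * (k == 0%N)%:R - f k) g n = c * g n - convol f g n.
Proof.
rewrite /convol; under eq_bigr do rewrite mulrBl.
rewrite big_split /= sumrN; congr (_ - _).
rewrite big_ord_recl /= mulr1 subn0 big1 ?addr0 // => i _.
by rewrite mulr0 mul0r.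
Qed.

(** Serves to separate the natural powers of [1 + t] from the three absolute series. *)
Lemma convol3_interchange {R : realType} (a b c f g h : nat -> R) (n : nat) :
  convol (convol a f) (convol (convol b g) (convol c h)) n =
  convol (convol a (convol b c)) (convol f (convol g h)) n.
Proof.
have swap (u v w z : nat -> R) m :
    convol (convol u v) (convol w z) m = convol (convol u w) (convol v z) m.
  rewrite -!convolA; apply: eq_convol => // i.
  rewrite !convolA; apply: eq_convol => // j; exact: convolC.
by rewrite (eq_convol _ (fun=> erefl) (swap b g c h)) swap.
Qed.

(** * Generalised binomial coefficients *)

Definition gbin {R : realType} (x : R) (k : nat) : R :=
  (k`!%:R)^-1 * \prod_(t < k) (x - t%:R).

Lemma gbin0 {R : realType} (x : R) : gbin x 0 = 1.
Proof. by rewrite /gbin big_ord0 fact0 invr1 mulr1. Qed.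

Lemma gbinS {R : realType} (x : R) (k : nat) :
  k.+1%:R * gbin x k.+1 = (x - k%:R) * gbin x k.
Proof.
rewrite /gbin big_ord_recr /= factS natrM invfM.
have k0 : k.+1%:R != 0 :> R by rewrite pnatr_eq0.
have f0 : k`!%:R != 0 :> R by rewrite pnatr_eq0 -lt0n fact_gt0.
by field; rewrite f0 addrC natr1 k0.
Qed.

Lemma gbin_succ {R : realType} (x : R) (k : nat) :
  k.+1%:R * gbin (1 + x) k.+1 = (1 + x) * gbin x k.
Proof.
elim: k => [|k IH]; first by rewrite gbinS !gbin0 subr0.
have k0 : k.+1%:R != 0 :> R by rewrite pnatr_eq0.
apply: (mulfI k0).
rewrite gbinS mulrCA IH [RHS]mulrCA gbinS.
by rewrite -(natr1 k); ring.
Qed.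

Lemma gbin_nat {R : realType} (m k : nat) : gbin (m%:R : R) k = 'C(m, k)%:R.
Proof.
elim: k => [|k IH]; first by rewrite gbin0 bin0.
have k0 : k.+1%:R != 0 :> R by rewrite pnatr_eq0.
apply: (mulfI k0); rewrite gbinS IH -natrM mul_bin_left natrM.
have [lekm|ltmk] := leqP k m; first by rewrite natrB.
by rewrite bin_small // !mulr0.
Qed.

(** Induction after multiplying by [n + 1 = i + (n + 1 - i)]: each part lowers one index by [gbinS],
    and the weights [x - i] and [y - (n - i)] add up to [x + y - n]. *)
Lemma gbin_vandermonde {R : realType} (x y : R) (n : nat) :
  convol (gbin x) (gbin y) n = gbin (x + y) n.
Proof.
elim: n => [|n IH]; first by rewrite /convol big_ord1 /= !gbin0 mulr1.
have k0 : n.+1%:R != 0 :> R by rewrite pnatr_eq0.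
apply: (mulfI k0); rewrite gbinS -IH.
transitivity (\sum_(i < n.+2) (i%:R * gbin x i) * gbin y (n.+1 - i) +
              \sum_(i < n.+2) gbin x i * ((n.+1 - i)%:R * gbin y (n.+1 - i))).
  rewrite /convol mulr_sumr -big_split; apply: eq_bigr => i _ /=.
  have -> : n.+1%:R = i%:R + (n.+1 - i)%:R :> R by rewrite -natrD subnKC ?leq_ord.
  by ring.
rewrite big_ord_recl /= mul0r mul0r add0r [X in _ + X]big_ord_recr /= subnn.
rewrite mul0r mulr0 addr0 -big_split /convol mulr_sumr.
apply: eq_bigr => i _ /=.
have le_in : (i <= n)%N by rewrite -ltnS ltn_ord.
rewrite /bump /= add1n subSS gbinS (subSn le_in) gbinS natrB //.
by ring.
Qed.

Lemma lfactor_gbin {R : realType} (n k : nat) (x : R) :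
  lfactor n k x = gbin (n%:R * x) k.
Proof. by []. Qed.

Lemma lebesgue_fun_convol {R : realType} (n : nat) (l : R * R * R) :
  lebesgue_fun n l =
  convol (fun k => `|gbin (n%:R * l.1.1) k|)
    (convol (fun k => `|gbin (n%:R * l.1.2) k|)
          (fun k => `|gbin (n%:R * l.2) k|)) n.
Proof.
apply: eq_bigr => i _; rewrite /convol mulr_sumr; apply: eq_bigr => j _.
by rewrite /lagr !lfactor_gbin 2!normrM -mulrA.
Qed.

(** Vandermonde and the triangle inequality; the coefficients of [(1 + t)^p] keep no absolute value
    because [p] is natural. *)
Lemma gbin_abs_le {R : realType} (p : nat) (u : R) (k : nat) :
  `|gbin (p%:R + u) k| <= convol (gbin p%:R) (fun j => `|gbin u j|) k.
Proof.
rewrite -gbin_vandermonde; apply: le_trans (ler_norm_sum _ _ _) _.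
apply: ler_sum => i _; rewrite normrM ler_pM //.
by rewrite gbin_nat ger0_norm.
Qed.

Lemma convol3_gbin_abs_le {R : realType} (p q r n : nat) (u v w : R) :
  convol (fun k => `|gbin (p%:R + u) k|)
    (convol (fun k => `|gbin (q%:R + v) k|) (fun k => `|gbin (r%:R + w) k|)) n <=
  convol (gbin (p + q + r)%:R)
    (convol (fun k => `|gbin u k|)
       (convol (fun k => `|gbin v k|) (fun k => `|gbin w k|))) n.
Proof.
have H (m : nat) (x : R) i :
    0 <= `|gbin (m%:R + x) i| <= convol (gbin m%:R) (fun j => `|gbin x j|) i.
  by rewrite normr_ge0 gbin_abs_le.
apply: le_trans (ler_convol n (H p u)
  (g' := convol (convol (gbin q%:R) (fun k => `|gbin v k|))
              (convol (gbin r%:R) (fun k => `|gbin w k|))) _) _.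
  by move=> i; rewrite convol_ge0 //=; apply: ler_convol.
rewrite convol3_interchange.
rewrite (@eq_convol _ _ (gbin (p + q + r)%:R) _ _ n _ (fun=> erefl)) // => i.
rewrite (eq_convol i (fun=> erefl) (gbin_vandermonde q%:R r%:R)).
by rewrite gbin_vandermonde -!natrD addnA.
Qed.

(* The coefficients of [(1 - t)^x]. *)
Definition altbin {R : realType} (x : R) (k : nat) : R := (-1) ^+ k * gbin x k.

Lemma altbin0 {R : realType} (x : R) : altbin x 0 = 1.
Proof. by rewrite /altbin gbin0 mulr1. Qed.

Lemma altbinS {R : realType} (x : R) (k : nat) :
  k.+1%:R * altbin x k.+1 = (k%:R - x) * altbin x k.
Proof. by rewrite /altbin mulrCA gbinS exprS; ring. Qed.

Lemma altbin_convol {R : realType} (x y : R) (n : nat) :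
  convol (altbin x) (altbin y) n = altbin (x + y) n.
Proof.
rewrite /altbin -gbin_vandermonde /convol mulr_sumr; apply: eq_bigr => i _.
have -> : (-1) ^+ n = (-1) ^+ i * (-1) ^+ (n - i) :> R.
  by rewrite -exprD subnKC ?leq_ord.
by ring.
Qed.

(* [bcoef x k / k] is the [k]-th coefficient of [1 - (1 - t)^x] for [k > 0]. *)
Definition bcoef {R : realType} (x : R) (k : nat) : R := - (k%:R * altbin x k).

Lemma bcoef1 {R : realType} (x : R) : bcoef x 1 = x.
Proof. by rewrite /bcoef altbinS altbin0 mulr1 sub0r opprK. Qed.

Lemma bcoefS {R : realType} (x : R) (k : nat) :
  bcoef x k.+2 = (1 - x / k.+1%:R) * bcoef x k.+1.
Proof.
rewrite /bcoef altbinS.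
have k0 : k.+1%:R != 0 :> R by rewrite pnatr_eq0.
by field; rewrite addrC natr1.
Qed.

Lemma bcoef_factor {R : realType} (x : R) (k : nat) : 0 <= x <= 1 ->
  0 <= 1 - x / k.+1%:R <= 1.
Proof.
move=> /andP[x0 x1].
have k1 : 0 < k.+1%:R :> R by rewrite ltr0n.
rewrite subr_ge0 gerBl divr_ge0 ?(ltW k1) // andbT.
by rewrite ler_pdivrMr // mul1r (le_trans x1) // ler1n.
Qed.

Lemma bcoef_ge0 {R : realType} (x : R) (k : nat) : 0 <= x <= 1 -> 0 <= bcoef x k.
Proof.
move=> x01; case: k => [|k]; first by rewrite /bcoef mul0r oppr0.
elim: k => [|k IH]; first by rewrite bcoef1; case/andP: x01.
by rewrite bcoefS mulr_ge0 //; case/andP: (bcoef_factor k x01).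
Qed.

Lemma bcoef_le {R : realType} (x : R) (k : nat) : 0 <= x <= 1 -> bcoef x k <= x.
Proof.
move=> x01; case: k => [|k].
  by rewrite /bcoef mul0r oppr0; case/andP: x01.
elim: k => [|k IH]; first by rewrite bcoef1.
rewrite bcoefS; apply: le_trans IH; rewrite ler_piMl ?bcoef_ge0 //.
by case/andP: (bcoef_factor k x01).
Qed.

(** From index 2 on the product contains the factor [1 - x], and the later factors lie in
    [[0, 1]]. *)
Lemma bcoef_le_var {R : realType} (x : R) (k : nat) : 0 <= x <= 1 ->
  bcoef x k.+2 <= x * (1 - x).
Proof.
move=> x01; elim: k => [|k IH]; first by rewrite bcoefS bcoef1 divr1 mulrC.
rewrite bcoefS; apply: le_trans IH; rewrite ler_piMl ?bcoef_ge0 //.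
by case/andP: (bcoef_factor k.+1 x01).
Qed.

(** Each factor satisfies [1 - x/t <= exp (- x/t)], and [1/t] dominates the increment
    [ln (t + 1) - ln t]. *)
Lemma bcoef_le_expR {R : realType} (x : R) (k : nat) : 0 <= x <= 1 ->
  bcoef x k.+1 <= x * expR (- (x * ln k.+1%:R)).
Proof.
move=> x01; have /andP[x0 x1] := x01.
elim: k => [|k IH]; first by rewrite bcoef1 ln1 mulr0 oppr0 expR0 mulr1.
have k1 : 0 < k.+1%:R :> R by rewrite ltr0n.
have lnS : ln k.+2%:R <= ln k.+1%:R + k.+1%:R^-1 :> R.
  have -> : k.+2%:R = k.+1%:R * (1 + k.+1%:R^-1) :> R.
    by rewrite mulrDr mulr1 divff ?gt_eqF // natr1.
  have v0 : 0 < k.+1%:R^-1 :> R by rewrite invr_gt0.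
  rewrite lnM ?posrE // ?addr_gt0 // lerD2l le_ln1Dx // (lt_trans _ v0) // ltrN10.
rewrite bcoefS.
apply: (@le_trans _ _
  (expR (- (x / k.+1%:R)) * (x * expR (- (x * ln k.+1%:R))))).
  apply: ler_pM => //.
  - by case/andP: (bcoef_factor k x01).
  - exact: bcoef_ge0.
  - exact: expR_ge1Dx.
rewrite mulrCA -expRD ler_wpM2l // ler_expR.
by rewrite -opprD lerN2 addrC -mulrDr ler_wpM2l.
Qed.

(** With [L] the logarithm, [x exp (- x L)] peaks at [x = 1/L] with value [1/(e L)]; this is
    [y <= exp (y - 1)] at [y = x L]. *)
Lemma bcoef_le_ln {R : realType} (x : R) (k : nat) : 0 <= x <= 1 ->
  bcoef x k.+2 <= (expR 1 * ln k.+2%:R)^-1.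
Proof.
move=> x01; apply: le_trans (bcoef_le_expR _ x01) _.
set L := ln _.
have L0 : 0 < L by rewrite ln_gt0 // ltr1n.
rewrite -[_^-1]mul1r ler_pdivlMr ?mulr_gt0 ?expR_gt0 // expRN.
rewrite [X in X <= _](_ : _ = (x * L * expR 1) / expR (x * L)); last by ring.
rewrite ler_pdivrMr ?expR_gt0 // mul1r.
have := expR_ge1Dx (x * L - 1); rewrite expRB ler_pdivlMr ?expR_gt0 //.
by rewrite addrC subrK.
Qed.

(** Reduces exponents in [[1, 2]], which occur as pair sums when [u + v + w = 2], to exponents in
    [[0, 1]]. *)
Lemma altbin_succ {R : realType} (v : R) (k : nat) :
  k.+2%:R * k.+1%:R * altbin (1 + v) k.+2 = (1 + v) * bcoef v k.+1.
Proof.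
rewrite /bcoef /altbin.
transitivity (k.+1%:R * (-1) ^+ k.+2 * (k.+2%:R * gbin (1 + v) k.+2)).
  by ring.
by rewrite gbin_succ !exprS; ring.
Qed.

(** All coefficients of [(1 - t)^x] after the constant 1 are nonpositive, so absolute values flip
    every sign but the first. *)
Lemma gbin_abs {R : realType} (x : R) (k : nat) : 0 <= x <= 1 ->
  `|gbin x k| = 2 * (k == 0%N)%:R - altbin x k.
Proof.
move=> x01; case: k => [|k].
  by rewrite altbin0 gbin0 normr1 /=; ring.
have k1 : 0 < k.+1%:R :> R by rewrite ltr0n.
rewrite /= mulr0 sub0r.
have -> : `|gbin x k.+1| = `|altbin x k.+1|.
  by rewrite /altbin [RHS]normrM normrX normrN1 expr1n mul1r.
rewrite ler0_norm //.
have := bcoef_ge0 k.+1 x01; rewrite /bcoef oppr_ge0 pmulr_rle0 //.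
Qed.

(** * Products of three absolute series *)

Definition abs3 {R : realType} (u v w : R) : nat -> R :=
  convol (fun k => `|gbin u k|) (convol (fun k => `|gbin v k|) (fun k => `|gbin w k|)).

(* Coefficients of [(2 - (1-t)^u) (2 - (1-t)^v) (2 - (1-t)^w)]. *)
Lemma abs3E {R : realType} (u v w : R) (s : nat) :
  0 <= u <= 1 -> 0 <= v <= 1 -> 0 <= w <= 1 ->
  abs3 u v w s.+1 =
  - (4 * (altbin u s.+1 + altbin v s.+1 + altbin w s.+1))
  + 2 * (altbin (u + v) s.+1 + altbin (u + w) s.+1 + altbin (v + w) s.+1)
  - altbin (u + v + w) s.+1.
Proof.
move=> u01 v01 w01.
have E2 k : convol (fun k => `|gbin v k|) (fun k => `|gbin w k|) k =
    4 * (k == 0%N)%:R - (2 * altbin v k + 2 * altbin w k - altbin (v + w) k).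
  rewrite (eq_convol k (fun i => gbin_abs i v01) (fun i => gbin_abs i w01)).
  rewrite convol_deltaB [X in _ - X]convolC convol_deltaB.
  by rewrite [X in _ - (_ - X)]convolC altbin_convol; ring.
rewrite /abs3 (eq_convol _ (fun i => gbin_abs i u01) E2).
rewrite convol_deltaB [X in _ - X = _]convolC convol_deltaB.
have -> : convol (fun k => 2 * altbin v k + 2 * altbin w k - altbin (v + w) k)
    (altbin u) s.+1 =
    2 * altbin (u + v) s.+1 + 2 * altbin (u + w) s.+1 - altbin (u + v + w) s.+1.
  rewrite -(addrA u) ![u + _]addrC -!altbin_convol /convol.
  rewrite !mulr_sumr -sumrN -!big_split.
  by apply: eq_bigr => i _ /=; ring.
by rewrite /=; ring.
Qed.

Lemma abs3_sum1 {R : realType} (u v w : R) (s : nat) :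
  0 <= u <= 1 -> 0 <= v <= 1 -> 0 <= w <= 1 -> u + v + w = 1 ->
  s.+2%:R * abs3 u v w s.+2 <= 4 * (bcoef u s.+2 + bcoef v s.+2 + bcoef w s.+2).
Proof.
move=> u01 v01 w01 sum1; rewrite abs3E // sum1.
have B (x : R) : 0 <= x <= 1 -> s.+2%:R * altbin x s.+2 <= 0.
  by move=> x01; rewrite -oppr_ge0; apply: (bcoef_ge0 s.+2).
have B1 : s.+2%:R * altbin 1 s.+2 = 0 :> R.
  apply/eqP; rewrite -oppr_eq0 -[_ == 0]/(bcoef 1 s.+2 == 0).
  rewrite eq_le bcoef_ge0 ?lexx ?ler01 //.
  by rewrite (le_trans (bcoef_le_var _ _)) ?lexx ?ler01 // subrr mulr0.
have /B b1 : 0 <= u + v <= 1 by lra.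
have /B b2 : 0 <= u + w <= 1 by lra.
have /B b3 : 0 <= v + w <= 1 by lra.
rewrite /bcoef; lra.
Qed.

Lemma abs3_1_sum1 {R : realType} (u v w : R) :
  0 <= u <= 1 -> 0 <= v <= 1 -> 0 <= w <= 1 -> u + v + w = 1 ->
  abs3 u v w 1 = 1.
Proof.
move=> u01 v01 w01 sum1; rewrite abs3E //.
have E (x : R) : altbin x 1 = - x.
  by rewrite -[in RHS](bcoef1 x) /bcoef mul1r opprK.
by rewrite !E; lra.
Qed.

(** Each pair sum [x] lies in [[1, 2]] and contributes at most [2 * 2 (x - 1)]. The pair sums total
    4, whence the final [4 (4 - 3) = 4]; the triple term has a favourable sign. *)
Lemma abs3_sum2 {R : realType} (u v w : R) (s : nat) :
  0 <= u <= 1 -> 0 <= v <= 1 -> 0 <= w <= 1 -> u + v + w = 2 ->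
  s.+2%:R * s.+1%:R * abs3 u v w s.+2 <=
  4 * s.+1%:R * (bcoef u s.+2 + bcoef v s.+2 + bcoef w s.+2) + 4.
Proof.
move=> u01 v01 w01 sum2; rewrite abs3E // sum2.
have B (x : R) : 1 <= x <= 2 ->
    0 <= s.+2%:R * s.+1%:R * altbin x s.+2 <= 2 * (x - 1).
  move=> x12; have x01 : 0 <= x - 1 <= 1 by lra.
  have -> : x = 1 + (x - 1) by ring.
  rewrite altbin_succ (_ : 1 + (x - 1) - 1 = x - 1); last by ring.
  have := bcoef_ge0 s.+1 x01; have := bcoef_le s.+1 x01; nra.
have /B b1 : 1 <= u + v <= 2 by lra.
have /B b2 : 1 <= u + w <= 2 by lra.
have /B b3 : 1 <= v + w <= 2 by lra.
have /B b4 : 1 <= (2 : R) <= 2 by lra.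
rewrite /bcoef; lra.
Qed.

(** * Binomial averages *)

Lemma bin_sub1 (n i : nat) : (i <= n)%N -> (n * 'C(n.-1, n - i) = i * 'C(n, i))%N.
Proof. by move=> le_in; rewrite mul_bin_down subKn // bin_sub. Qed.

Lemma bin_sub2 (n i : nat) : (i <= n)%N ->
  (n * n.-1 * 'C(n.-2, n - i) = i * i.-1 * 'C(n, i))%N.
Proof.
move=> le_in; rewrite -mulnA mul_bin_down mulnCA bin_sub1 // mulnA.
by rewrite (_ : n.-1 - (n - i) = i.-1)%N 1?(mulnC i); lia.
Qed.

Lemma sum_bin_expr {R : realType} (x : R) (n : nat) :
  \sum_(i < n.+1) x ^+ i * 'C(n, i)%:R = (1 + x) ^+ n.
Proof.
by rewrite exprDn; apply: eq_bigr => i _; rewrite expr1n mul1r mulr_natr.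
Qed.

Lemma sum_bin {R : realType} (n : nat) :
  \sum_(i < n.+1) 'C(n, i)%:R = 2 ^+ n :> R.
Proof.
rewrite -[2]/(1 + 1) -sum_bin_expr.
by apply: eq_bigr => i _; rewrite expr1n mul1r.
Qed.

Lemma sum_mul_bin {R : realType} (n : nat) :
  2 * \sum_(i < n.+1) i%:R * 'C(n, i)%:R = n%:R * 2 ^+ n :> R.
Proof.
case: n => [|n]; first by rewrite big_ord1 !mul0r mulr0.
rewrite big_ord_recl mul0r add0r.
under eq_bigr => i _ do rewrite -natrM -mul_bin_diag natrM.
by rewrite -mulr_sumr /= sum_bin exprS; ring.
Qed.

Lemma convol_bin1 {R : realType} (n : nat) (c : nat -> R) :
  n%:R * convol (gbin n.-1%:R) c n =
  \sum_(i < n.+1) (i%:R * c i) * 'C(n, i)%:R.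
Proof.
rewrite convolC /convol mulr_sumr; apply: eq_bigr => i _.
have le_in : (i <= n)%N by rewrite -ltnS.
by rewrite gbin_nat mulrCA -natrM bin_sub1 // natrM; ring.
Qed.

Lemma convol_bin2 {R : realType} (n : nat) (c : nat -> R) :
  n%:R * n.-1%:R * convol (gbin n.-2%:R) c n =
  \sum_(i < n.+1) (i%:R * i.-1%:R * c i) * 'C(n, i)%:R.
Proof.
rewrite convolC /convol mulr_sumr; apply: eq_bigr => i _.
have le_in : (i <= n)%N by rewrite -ltnS.
by rewrite gbin_nat mulrCA -!natrM bin_sub2 // !natrM; ring.
Qed.

(** Under binomial weights the constant sums to [2^n] and the geometric term to [(1 + 1/2)^n]. *)
Lemma convol_bin1_le {R : realType} (n : nat) (c : nat -> R) (M T : R) :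
  (forall s, (s <= n)%N -> s%:R * c s <= M + T * 2^-1 ^+ s) ->
  n%:R * convol (gbin n.-1%:R) c n <= M * 2 ^+ n + T * (1 + 2^-1) ^+ n.
Proof.
move=> H; rewrite convol_bin1 -(sum_bin n) -sum_bin_expr !mulr_sumr -big_split /=.
apply: ler_sum => i _; rewrite mulrA -mulrDl ler_wpM2r // H //.
by rewrite -ltnS.
Qed.

Lemma convol_bin2_le {R : realType} (n : nat) (c : nat -> R) (M T : R) :
  (1 < n)%N -> 0 <= T -> 8 / n%:R <= M <= 4 ->
  (forall s, (s.+2 <= n)%N ->
     s.+2%:R * s.+1%:R * c s.+2 <= s.+1%:R * (M + T * 2^-1 ^+ s.+2) + 4) ->
  n%:R * convol (gbin n.-2%:R) c n <= M * 2 ^+ n + T * (1 + 2^-1) ^+ n.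
Proof.
move=> n1 T0 /andP[M8 M4] H.
have n0 : 0 < n%:R :> R by rewrite ltr0n; lia.
have m0 : 0 < n.-1%:R :> R by rewrite ltr0n; lia.
have nE : n%:R = n.-1%:R + 1 :> R by rewrite natr1 prednK //; lia.
rewrite -(ler_pM2l m0) mulrCA mulrA convol_bin2.
have M0 : 0 <= M by apply: le_trans M8; rewrite divr_ge0 // ltW.
(* The hypothesis starts at index 2; at [i = 0] it is [M <= 4] that keeps the new summand
   nonnegative. *)
apply: (@le_trans _ _ (\sum_(i < n.+1)
   ((i%:R - 1) * M + 4 + n.-1%:R * T * 2^-1 ^+ i) * 'C(n, i)%:R)).
  apply: ler_sum => i _; rewrite ler_wpM2r //.
  have e0 k : 0 <= 2^-1 ^+ k :> R by rewrite exprn_ge0 // invr_ge0.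
  have le_in : (i <= n)%N by rewrite -ltnS.
  have P k : 0 <= n.-1%:R * T * 2^-1 ^+ k by rewrite !mulr_ge0 // ltW.
  case: (nat_of_ord i) le_in => [|[|s]] le_sn.
  - by rewrite mul0r mul0r; have := P 0%N; lra.
  - by rewrite mulr0 mul0r; have := P 1%N; lra.
  - apply: le_trans (H _ le_sn) _.
    rewrite mulrDr -(natr1 s.+1) addrK addrAC lerD2l -mulrA.
    apply: ler_wpM2r; first exact: mulr_ge0 T0 (e0 _).
    by rewrite ler_nat; lia.
have -> : \sum_(i < n.+1)
   ((i%:R - 1) * M + 4 + n.-1%:R * T * 2^-1 ^+ i) * 'C(n, i)%:R =
   M * (\sum_(i < n.+1) i%:R * 'C(n, i)%:R) + (4 - M) * 2 ^+ n +
   n.-1%:R * T * (1 + 2^-1) ^+ n.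
  rewrite -(sum_bin n) -sum_bin_expr !mulr_sumr -!big_split /=.
  by apply: eq_bigr => i _; ring.
rewrite [leRHS]mulrDr [X in _ <= _ + X]mulrA lerD2r.
have Q0 : 0 < 2 ^+ n :> R by rewrite exprn_gt0.
have := sum_mul_bin (R := R) n.
set S1 := \sum_(i < _) _; move=> S1E.
have -> : S1 = n%:R * 2 ^+ n / 2 by rewrite -S1E; field.
rewrite (_ : _ + _ = (M * n%:R / 2 + (4 - M)) * 2 ^+ n); last by field.
rewrite [leRHS]mulrA ler_pM2r //.
(* What is left, [M n / 2 + 4 - M <= (n - 1) M], is equivalent to [8 / n <= M]. *)
move: M8; rewrite ler_pdivrMr // nE; lra.
Qed.

(** * Reduction to fractional parts *)

Lemma nat_frac {R : realType} (x : R) : 0 <= x ->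
  exists (p : nat) (u : R), x = p%:R + u /\ 0 <= u < 1.
Proof.
move=> x0; have /andP[a b] := Num.Theory.truncn_itv x0.
exists (Num.truncn x), (x - (Num.truncn x)%:R); split; first by ring.
by move: b; rewrite -natr1; lra.
Qed.

(** Fractional parts in [[0, 1)] have an integer sum below 3; admitting the value 1 absorbs the sum
    0, so two cases remain. *)
Lemma simplex_frac {R : realType} (n : nat) (x y z : R) : (0 < n)%N ->
  0 <= x -> 0 <= y -> 0 <= z -> x + y + z = n%:R ->
  exists (p q r : nat) (u v w : R),
  [/\ x = p%:R + u, y = q%:R + v & z = r%:R + w] /\
  [/\ 0 <= u <= 1, 0 <= v <= 1 & 0 <= w <= 1] /\
  ((u + v + w = 1 /\ (p + q + r)%N = n.-1) \/
   (u + v + w = 2 /\ (p + q + r)%N = n.-2)).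
Proof.
move=> n0 /nat_frac[p [u [-> u01]]] /nat_frac[q [v [-> v01]]].
move=> /nat_frac[r [w [-> w01]]] sumE.
have tot : u + v + w + (p + q + r)%:R = n%:R by rewrite !natrD -sumE; ring.
have le_n : (p + q + r <= n)%N.
  by rewrite -(ler_nat R) -tot; lra.
have lt_n : (n < p + q + r + 3)%N.
  by rewrite -(ltr_nat R) natrD -tot; lra.
have sE : u + v + w = (n - (p + q + r))%:R by rewrite natrB // -tot addrK.
have : (n - (p + q + r) < 3)%N by lia.
case dE : (n - (p + q + r))%N sE => [|[|[|//]]] sE _.
- (* [x], [y], [z] are integers: take fractional part 1 for a positive one. *)
  have [u0 [v0 w0]] : u = 0 /\ v = 0 /\ w = 0 by lra.
  case: p le_n lt_n dE sumE tot => [|p] le_n lt_n dE _ _.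
    case: q le_n lt_n dE => [|q] le_n lt_n dE.
      case: r le_n lt_n dE => [|r] le_n lt_n dE; first by lia.
      exists 0%N, 0%N, r, u, v, 1; split.
        by split=> //; rewrite -natr1 w0 addr0.
      by split; [split; lra|left; split; [lra|lia]].
    exists 0%N, q, r, u, 1, w; split.
      by split=> //; rewrite -natr1 v0 addr0.
    by split; [split; lra|left; split; [lra|lia]].
  exists p, q, r, 1, v, w; split.
    by split=> //; rewrite -natr1 u0 addr0.
  by split; [split; lra|left; split; [lra|lia]].
- exists p, q, r, u, v, w; split; first by [].
  by split; [split; lra|left; split; [|lia]].
- exists p, q, r, u, v, w; split; first by [].
  by split; [split; lra|right; split; [|lia]].
Qed.

(** [M + T / 2^s] is an envelope with a constant for large [s] and a geometric allowance for small
    [s]. The condition [1 <= M + T / 2] covers [s = 1] when [u + v + w = 1]. *)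
Lemma lebesgue_fun_le {R : realType} (n : nat) (M T : R) (l : R * R * R) :
  (1 < n)%N -> 0 <= T -> 8 / n%:R <= M <= 4 -> 1 <= M + T / 2 ->
  (forall s u v w, (s.+2 <= n)%N -> 0 <= u <= 1 -> 0 <= v <= 1 -> 0 <= w <= 1 ->
     u + v + w = 1 \/ u + v + w = 2 ->
     4 * (bcoef u s.+2 + bcoef v s.+2 + bcoef w s.+2) <= M + T * 2^-1 ^+ s.+2) ->
  simplex l ->
  n%:R * lebesgue_fun n l <= M * 2 ^+ n + T * (1 + 2^-1) ^+ n.
Proof.
move=> n1 T0 M84 MT H [l1 [l2 [l3 sumE]]].
have n0 : 0 <= n%:R :> R by [].
have [|||||p [q [r [u [v [w [[xE yE zE] [[u01 v01 w01] cases]]]]]]]] :=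
  @simplex_frac R n (n%:R * l.1.1) (n%:R * l.1.2) (n%:R * l.2).
- by lia.
- exact: mulr_ge0.
- exact: mulr_ge0.
- exact: mulr_ge0.
- by rewrite -!mulrDr sumE mulr1.
have M0 : 0 <= M.
  by case/andP: M84 => M8 _; apply: le_trans M8; rewrite divr_ge0.
have e0 k : 0 <= 2^-1 ^+ k :> R by rewrite exprn_ge0 // invr_ge0.
have lebE : n%:R * lebesgue_fun n l <=
    n%:R * convol (gbin (p + q + r)%:R) (abs3 u v w) n.
  by rewrite ler_wpM2l // lebesgue_fun_convol xE yE zE convol3_gbin_abs_le.
apply: le_trans lebE _.
case: cases => -[s1 ->].
- apply: convol_bin1_le => -[|[|s]] les.
  + by rewrite mul0r addr_ge0 // mulr_ge0.
  + by rewrite mul1r abs3_1_sum1 // expr1.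
  + by apply: le_trans (abs3_sum1 _ _ _ _ _) _ => //; apply: H => //; left.
- apply: convol_bin2_le => // s les.
  apply: le_trans (abs3_sum2 _ _ _ _ _) _ => //.
  rewrite lerD2r mulrAC mulrC ler_wpM2l //.
  by apply: H => //; right.
Qed.

(** * Numerical estimates *)

Lemma le_sqr_trans {R : realType} (a b x : R) :
  0 <= a -> b <= a ^+ 2 -> a <= x -> b <= x ^+ 2.
Proof.
move=> a0 ab ax; apply: le_trans ab _.
by rewrite lerXn2r ?nnegrE // (le_trans a0).
Qed.

Lemma expR_pow256 {R : realType} (x : R) :
  expR x = ((((((((expR (x / 256)) ^+ 2) ^+ 2) ^+ 2) ^+ 2) ^+ 2) ^+ 2) ^+ 2) ^+ 2.
Proof. by rewrite -!exprM -expRM_natl; congr expR; rewrite /=; field. Qed.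

(* Rounded repeated squaring of [1 + 1/256 <= expR (1/256)]. *)
Lemma expR1_ge {R : realType} : 271 / 100 <= expR 1 :> R.
Proof.
rewrite expR_pow256.
apply: (@le_sqr_trans R ((1646 + 989 / 1000) / 1000)); [lra|lra|].
apply: (@le_sqr_trans R ((1283 + 351 / 1000) / 1000)); [lra|lra|].
apply: (@le_sqr_trans R ((1132 + 851 / 1000) / 1000)); [lra|lra|].
apply: (@le_sqr_trans R ((1064 + 355 / 1000) / 1000)); [lra|lra|].
apply: (@le_sqr_trans R ((1031 + 676 / 1000) / 1000)); [lra|lra|].
apply: (@le_sqr_trans R ((1015 + 715 / 1000) / 1000)); [lra|lra|].
apply: (@le_sqr_trans R ((1007 + 827 / 1000) / 1000)); [lra|lra|].
apply: (@le_sqr_trans R (257 / 256)); [lra|lra|].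
by apply: le_trans (expR_ge1Dx _); lra.
Qed.

(** Since [1 + x <= expR x] only bounds from below, the inverse of e is treated, starting from
    [1 - 1/256 <= expR (- 1/256)]. *)
Lemma expR1_le {R : realType} : expR 1 <= 273 / 100 :> R.
Proof.
suff : (273 / 100)^-1 <= (expR 1)^-1 :> R.
  by rewrite lef_pV2 // posrE ?expR_gt0 //; lra.
rewrite -expRN [leRHS]expR_pow256 invf_div.
apply: (@le_sqr_trans R ((605 + 881 / 1000) / 1000)); [lra|lra|].
apply: (@le_sqr_trans R ((778 + 384 / 1000) / 1000)); [lra|lra|].
apply: (@le_sqr_trans R ((882 + 261 / 1000) / 1000)); [lra|lra|].
apply: (@le_sqr_trans R ((939 + 288 / 1000) / 1000)); [lra|lra|].
apply: (@le_sqr_trans R ((969 + 169 / 1000) / 1000)); [lra|lra|].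
apply: (@le_sqr_trans R ((984 + 464 / 1000) / 1000)); [lra|lra|].
apply: (@le_sqr_trans R ((992 + 202 / 1000) / 1000)); [lra|lra|].
apply: (@le_sqr_trans R (255 / 256)); [lra|lra|].
by apply: le_trans (expR_ge1Dx _); lra.
Qed.

(** Tangent to [ln] at [e^3], about 20, which is close to [n/2] for [n] near the threshold 35. *)
Lemma ln_le_tangent {R : realType} (x : R) : 0 < x ->
  ln x <= 2 + x / expR 1 ^+ 3.
Proof.
move=> x0.
have e0 : 0 < expR 1 ^+ 3 :> R by rewrite exprn_gt0 ?expR_gt0.
have y0 : 0 < x / expR 1 ^+ 3 by rewrite divr_gt0.
have : ln (1 + (x / expR 1 ^+ 3 - 1)) <= x / expR 1 ^+ 3 - 1.
  by apply: le_ln1Dx; lra.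
rewrite addrC subrK ln_div ?posrE // lnXn ?expR_gt0 // expRK; lra.
Qed.

(** With sum [S], the total of [u (1 - u)] is at most [S - S^2 / 3], which is [2/3] both for [S = 1]
    and for [S = 2]. *)
Lemma bcoef3_le {R : realType} (u v w : R) (s : nat) :
  0 <= u <= 1 -> 0 <= v <= 1 -> 0 <= w <= 1 ->
  u + v + w = 1 \/ u + v + w = 2 ->
  4 * (bcoef u s.+2 + bcoef v s.+2 + bcoef w s.+2) <= 8 / 3.
Proof.
move=> u01 v01 w01 sE.
have hu := bcoef_le_var s u01; have hv := bcoef_le_var s v01.
have hw := bcoef_le_var s w01.
suff : u * (1 - u) + v * (1 - v) + w * (1 - w) <= 2 / 3 by lra.
have sq : 0 <= (u - v) ^+ 2 + (u - w) ^+ 2 + (v - w) ^+ 2.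
  by rewrite !addr_ge0 // sqr_ge0.
by case: sE => sE; have wE : w = (u + v + w) - u - v by [ring];
   move: sq; rewrite wE sE; nra.
Qed.

Lemma bcoef3_le_ln {R : realType} (u v w y : R) (s : nat) :
  0 <= u <= 1 -> 0 <= v <= 1 -> 0 <= w <= 1 -> 1 < y <= s.+2%:R ->
  4 * (bcoef u s.+2 + bcoef v s.+2 + bcoef w s.+2) <= 12 / (expR 1 * ln y).
Proof.
move=> u01 v01 w01 /andP[y1 ys].
have hu := bcoef_le_ln s u01; have hv := bcoef_le_ln s v01.
have hw := bcoef_le_ln s w01.
have L0 : 0 < ln y by rewrite ln_gt0.
have LL : ln y <= ln s.+2%:R by rewrite ler_ln ?posrE ?ltr0n // (lt_trans _ y1).
have : (expR 1 * ln s.+2%:R)^-1 <= (expR 1 * ln y)^-1.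
  rewrite lef_pV2 ?posrE ?mulr_gt0 ?expR_gt0 //; last exact: lt_le_trans LL.
  by rewrite ler_wpM2l // expR_ge0.
lra.
Qed.

Lemma mu_bound_ge0 {R : realType} (n : nat) : 0 <= mu_bound R n.
Proof.
have l0 : 0 <= ln n%:R :> R.
  by case: n => [|n]; [rewrite ln0|rewrite ln_ge0 // ler1n].
rewrite /mu_bound addr_ge0 // divr_ge0 ?powR_ge0 ?exprn_ge0 //.
  by rewrite !mulr_ge0 ?expR_ge0 ?exprn_ge0.
by rewrite !mulr_ge0 ?expR_ge0 ?exprn_ge0.
Qed.

(** * The Lebesgue function for small and large [n] *)

Lemma lebesgue_fun_le_small {R : realType} (n : nat) (l : R * R * R) :
  (4 <= n)%N -> simplex l -> n%:R * lebesgue_fun n l <= 8 / 3 * 2 ^+ n.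
Proof.
move=> n4 sl.
have N4 : 4 <= n%:R :> R by rewrite ler_nat.
(* A zero tail is added so that the envelope has [M = 8/3] and [T = 0]. *)
rewrite -[leRHS]addr0 -[X in _ + X](mul0r ((1 + 2^-1) ^+ n)).
apply: lebesgue_fun_le => //; first by lia.
- by rewrite ler_pdivrMr; [apply/andP; split; lra|lra].
- by lra.
- by move=> s u v w _ *; rewrite mul0r addr0 bcoef3_le.
Qed.

Lemma ln_div3_ge2 {R : realType} (x : R) : 35 <= x -> 2 <= ln (x / 3).
Proof.
move=> x35; rewrite -[2](@expRK R) ler_ln ?posrE ?expR_gt0 //; last by lra.
have -> : expR 2 = expR 1 ^+ 2 :> R by rewrite -expRM_natl mulr1.
have := @expR1_le R; have := @expR1_ge R; nra.
Qed.

(** Here [T = 8/3 * 2^(n/3)], so that [T / 2^s] alone exceeds the bound [8/3] when [s < n/3]; for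
    larger [s] the constant [M] suffices. *)
Lemma lebesgue_fun_le_large {R : realType} (n : nat) (l : R * R * R) :
  (35 <= n)%N -> simplex l ->
  n%:R * lebesgue_fun n l <=
  12 / (expR 1 * ln (n%:R / 3)) * 2 ^+ n +
  8 / 3 * expR (n%:R / 3 * ln 2) * (1 + 2^-1) ^+ n.
Proof.
move=> n35 sl.
have N35 : 35 <= n%:R :> R by rewrite ler_nat.
have L2 := ln_div3_ge2 N35.
have e1 := @expR1_ge R; have e2 := @expR1_le R.
have ln20 : 0 <= ln 2 :> R by rewrite ln_ge0 // ler1n.
have eL5 : 5 <= expR 1 * ln (n%:R / 3) :> R.
  by apply: le_trans (ler_pM _ _ e1 L2); lra.
have eL0 : 0 < expR 1 * ln (n%:R / 3) :> R by lra.
have T1 : 1 <= expR (n%:R / 3 * ln 2) :> R.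
  by rewrite -[leLHS]expR0 ler_expR mulr_ge0 //; lra.
have M0 : 0 <= 12 / (expR 1 * ln (n%:R / 3)) :> R by rewrite divr_ge0 // ltW.
apply: lebesgue_fun_le => //.
- by lia.
- apply/andP; split; last by rewrite ler_pdivrMr //; lra.
  have N0 : 0 < n%:R :> R by lra.
  rewrite ler_pdivrMr // mulrAC ler_pdivlMr //.
  have : ln (n%:R / 3) <= n%:R / 3 :> R by rewrite ltW // ln_sublinear //; lra.
  nra.
- by lra.
- move=> s u v w les u01 v01 w01 sE.
  have [le_ns|lt_sn] := lerP (n%:R / 3) (s.+2%:R : R).
    apply: le_trans (bcoef3_le_ln u01 v01 w01 (y := n%:R / 3) _) _.
      by rewrite le_ns andbT; lra.
    by rewrite lerDl mulr_ge0 ?exprn_ge0 ?invr_ge0 // mulr_ge0 ?expR_ge0 ?divr_ge0.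
  apply: le_trans (bcoef3_le _ u01 v01 w01 sE) _.
  have -> : 2^-1 ^+ s.+2 = expR (- (s.+2%:R * ln 2)) :> R.
    by rewrite expRN expRM_natl lnK ?posrE // exprVn.
  rewrite -[_ * expR _ * expR _]mulrA -expRD -mulNr -mulrDl.
  have : 1 <= expR ((n%:R / 3 - s.+2%:R) * ln 2) :> R.
    by rewrite -[leLHS]expR0 ler_expR mulr_ge0 // subr_ge0 ltW.
  lra.
Qed.

(* With [r = ln (32/27) / 3] the tail is [exp (- r n)], and [r >= 5/96]. *)
Lemma tail_le {R : realType} (n : nat) :
  expR (n%:R / 3 * ln 2) * (1 + 2^-1) ^+ n * (1 + 5 * n%:R / 384) ^+ 4
  <= 2 ^+ n :> R.
Proof.
set y := 5 * n%:R / 96 : R.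
have y0 : 0 <= y by rewrite /y !mulr_ge0 // invr_ge0.
have hy : (1 + 5 * n%:R / 384) ^+ 4 <= expR y :> R.
  have -> : y = 4%:R * (y / 4) by field.
  have y1 : 0 <= 1 + 5 * n%:R / 384 :> R by rewrite /y in y0; lra.
  rewrite expRM_natl; apply: lerXn2r; rewrite ?nnegrE.
  - exact: y1.
  - exact: expR_ge0.
  - by apply: le_trans (expR_ge1Dx _); rewrite /y; lra.
have c2 : (2 : R) \is Num.pos by rewrite posrE.
have c3 : (1 + 2^-1 : R) \is Num.pos by rewrite posrE; lra.
have e2 : 2 ^+ n = expR (n%:R * ln 2) :> R by rewrite expRM_natl lnK.
have e3 : (1 + 2^-1) ^+ n = expR (n%:R * ln (1 + 2^-1)) :> R by rewrite expRM_natl lnK.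
apply: le_trans (ler_wpM2l _ hy) _.
  by rewrite mulr_ge0 ?expR_ge0 // exprn_ge0.
rewrite e2 e3 -!expRD ler_expR /y.
(* This is [ln (27/32) <= - 5/32], as [27/32 = 1 - 5/32]. *)
have key : ln 2 + 3 * ln (1 + 2^-1) + 5 / 32 <= 3 * ln 2 :> R.
  have : ln (1 + (- (5 / 32))) <= - (5 / 32) :> R by apply: le_ln1Dx; lra.
  have -> : 1 + (- (5 / 32)) = 2 * (1 + 2^-1) ^+ 3 / 2 ^+ 3 :> R by field.
  have p3 : ((1 + 2^-1) ^+ 3 : R) \is Num.pos by rewrite posrE exprn_gt0.
  have p2 : (2 ^+ 3 : R) \is Num.pos by rewrite posrE exprn_gt0.
  rewrite ln_div ?posrE ?mulr_gt0 // lnM // !lnXn //; lra.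
have := ler_wpM2l (ler0n R n) key; lra.
Qed.

(** * Comparison with the stated bound *)

Lemma le_bound_of_scaled {R : realType} (n : nat) (K x : R) : (4 <= n)%N ->
  n%:R * x <= K * 2 ^+ n ->
  K * (expR 1 * ln (n%:R / 2)) * (n%:R - 3) <= 14 * (n%:R + 12) ->
  x <= (7 + mu_bound R n) * (2 ^+ n.+1 / (expR 1 * n%:R * (ln n%:R - ln 2)))
       * (1 + 15 / (n%:R - 3)).
Proof.
move=> n4; have N4 : 4 <= n%:R :> R by rewrite ler_nat.
have c2 : (2 : R) \is Num.pos by rewrite posrE.
have cn : (n%:R : R) \is Num.pos by rewrite posrE; lra.
have L0 : 0 < ln (n%:R / 2) :> R by rewrite ln_gt0 //; lra.
have N0 : 0 < n%:R :> R by lra.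
have N3 : 0 < n%:R - 3 :> R by lra.
have e0 := @expR_gt0 R 1.
have Q0 : 0 < 2 ^+ n :> R by rewrite exprn_gt0.
rewrite -ln_div //; set L := ln _ in L0 *; set N := n%:R in N0 N3 N4 *.
move=> hx hK.
(* The nonnegative [mu_bound] is given away; [7 * 2^(n+1) = 14 * 2^n] and
   [1 + 15/(N - 3) = (N + 12)/(N - 3)] then match the hypothesis on [K]. *)
apply: (@le_trans _ _ (7 * (2 ^+ n.+1 / (expR 1 * N * L)) * (1 + 15 / (N - 3)))).
  have -> : 7 * (2 ^+ n.+1 / (expR 1 * N * L)) * (1 + 15 / (N - 3)) =
      14 * (N + 12) * 2 ^+ n / (expR 1 * L * (N - 3)) / N.
    by rewrite exprS; field; rewrite !gt_eqF.
  rewrite ler_pdivlMr // mulrC; apply: le_trans hx _.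
  rewrite ler_pdivlMr ?mulr_gt0 // mulrAC ler_wpM2r ?(ltW Q0) //.
  by rewrite mulrA.
have F0 : 0 <= 1 + 15 / (N - 3) by rewrite addr_ge0 // divr_ge0 // ltW.
have G0 : 0 <= 2 ^+ n.+1 / (expR 1 * N * L).
  by rewrite divr_ge0 // ?exprn_ge0 // !mulr_ge0 // ltW.
do 2 (apply: ler_wpM2r => //).
by rewrite lerDl mu_bound_ge0.
Qed.

Lemma small_case {R : realType} (x : R) : 4 <= x <= 34 ->
  8 / 3 * (expR 1 * ln (x / 2)) * (x - 3) <= 14 * (x + 12).
Proof.
move=> /andP[x4 x34].
have e1 := @expR1_ge R; have e2 := @expR1_le R; have e0 := @expR_gt0 R 1.
have := @ln_le_tangent R (x / 2) ltac:(lra); set L := ln _ => hL.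
have esq : 73 / 10 <= expR 1 ^+ 2 :> R by nra.
have h : expR 1 * L <= 546 / 100 + x / 2 / (73 / 10).
  apply: (@le_trans _ _ (expR 1 * (2 + x / 2 / expR 1 ^+ 3))).
    by rewrite ler_wpM2l // ltW.
  have -> : expR 1 * (2 + x / 2 / expR 1 ^+ 3) = 2 * expR 1 + x / 2 / expR 1 ^+ 2.
    by field; rewrite gt_eqF.
  apply: lerD; first by lra.
  apply: ler_wpM2l; first by lra.
  by rewrite lef_pV2 // posrE ?exprn_gt0.
rewrite -mulrA; have x3 : 0 <= x - 3 by lra.
have := ler_wpM2r x3 h.
(* The bounding expression is a convex quadratic in [x], so it is enough that the inequality holds
   at 4 and at 34, where it is nearly tight. *)
have : 0 <= (x - 4) * (34 - x) by apply: mulr_ge0; lra.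
lra.
Qed.

Lemma large_case {R : realType} (x : R) : 35 <= x ->
  8 / 3 * (expR 1 * ln (x / 2)) * (x - 3) <= 210 * (1 + 5 * x / 384) ^+ 4.
Proof.
move=> x35.
have e1 := @expR1_ge R; have e2 := @expR1_le R; have e0 := @expR_gt0 R 1.
have L0 : 0 <= ln (x / 2) by rewrite ln_ge0 //; lra.
have := @ln_le_tangent R (x / 2) ltac:(lra); set L := ln _ in L0 * => hL.
have esq : 73 / 10 <= expR 1 ^+ 2 :> R by nra.
have ecub : 197 / 10 <= expR 1 ^+ 3 :> R by rewrite exprS; nra.
have h : L <= 2 + x / 2 / (197 / 10).
  apply: le_trans hL _; rewrite lerD2l ler_wpM2l //; first by lra.
  by rewrite lef_pV2 ?posrE ?exprn_gt0 //; lra.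
have eL : expR 1 * L <= 273 / 100 * (2 + x / 2 / (197 / 10)).
  by apply: ler_pM => //; exact: ltW.
set z := 1 + 5 * x / 384.
have -> : z ^+ 4 = (z ^+ 2) ^+ 2 by rewrite -exprM.
(* Tangent to the square at [z^2 = 26/10], which lowers the quartic to a quadratic. *)
have hz : 52 / 10 * z ^+ 2 - 676 / 100 <= (z ^+ 2) ^+ 2.
  by have := sqr_ge0 (z ^+ 2 - 26 / 10); lra.
apply: (@le_trans _ _
  (8 / 3 * (273 / 100 * (2 + x / 2 / (197 / 10))) * (x - 3))).
  by rewrite ler_wpM2r ?ler_wpM2l //; lra.
apply: (@le_trans _ _ (210 * (52 / 10 * z ^+ 2 - 676 / 100))); last by lra.
rewrite /z; nra.
Qed.

(** Equivalent to [3^7 / 2^6 <= x], where the left side is about 34.2. *)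
Lemma ln_ratio {R : realType} (x : R) : 35 <= x ->
  6 * ln (x / 2) <= 7 * ln (x / 3).
Proof.
move=> x35.
have x2 : 0 < x / 2 by lra.
have x3 : 0 < x / 3 by lra.
rewrite mulr_natl -lnXn // mulr_natl -lnXn // ler_ln ?posrE ?exprn_gt0 //.
have -> : (x / 3) ^+ 7 = x ^+ 6 * (x / 2187) by field.
have -> : (x / 2) ^+ 6 = x ^+ 6 * (1 / 64) by field.
by rewrite ler_wpM2l ?exprn_ge0 //; lra.
Qed.

Lemma lebesgue_fun_bound {R : realType} (n : nat) (l : R * R * R) :
  (4 <= n)%N -> simplex l ->
  lebesgue_fun n l <=
    (7 + mu_bound R n) * (2 ^+ n.+1 / (expR 1 * n%:R * (ln n%:R - ln 2)))
    * (1 + 15 / (n%:R - 3)).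
Proof.
move=> n4 sl.
have [n34|n35] := leqP n 34.
  apply: le_bound_of_scaled (lebesgue_fun_le_small n4 sl) _ => //.
  by apply: small_case; rewrite !ler_nat n4.
have N35 : 35 <= n%:R :> R by rewrite ler_nat.
have Q0 : 0 < 2 ^+ n :> R by rewrite exprn_gt0.
pose z : R := (1 + 5 * n%:R / 384) ^+ 4.
have z0 : 0 < z by apply: exprn_gt0; lra.
pose M : R := 12 / (expR 1 * ln (n%:R / 3)).
(* The budget splits as [14 (n + 12) = 14 (n - 3) + 210]: the first part pays for [M], the second
   for the tail [8/3 / z]. *)
apply: (@le_bound_of_scaled _ _ (M + 8 / 3 / z)) => //.
  apply: le_trans (lebesgue_fun_le_large n35 sl) _.
  rewrite [leRHS]mulrDl lerD2l -!mulrA ler_wpM2l // ler_wpM2l ?invr_ge0 //.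
  by rewrite ler_pdivlMl // [n%:R * _]mulrA mulrC; exact: tail_le.
have e0 := @expR_gt0 R 1.
have L2 : 0 < ln (n%:R / 2) :> R by rewrite ln_gt0 //; lra.
have L3 := ln_div3_ge2 N35.
have N3 : 0 < n%:R - 3 :> R by lra.
have hM : M * (expR 1 * ln (n%:R / 2)) <= 14.
  have -> : M * (expR 1 * ln (n%:R / 2)) = 12 * ln (n%:R / 2) / ln (n%:R / 3).
    by rewrite /M; field; rewrite !gt_eqF //; lra.
  by rewrite ler_pdivrMr; have := ln_ratio N35; lra.
have hT : 8 / 3 / z * (expR 1 * ln (n%:R / 2)) * (n%:R - 3) <= 210.
  have -> : 8 / 3 / z * (expR 1 * ln (n%:R / 2)) * (n%:R - 3) =
      8 / 3 * (expR 1 * ln (n%:R / 2)) * (n%:R - 3) / z.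
    by field; rewrite gt_eqF.
  by rewrite ler_pdivrMr // large_case.
have := ler_wpM2r (ltW N3) hM; lra.
Qed.

(** * Decay of [mu_bound] *)

Lemma inv_expR_lin_le {R : realType} (c : R) (k n : nat) : 0 < c -> (0 < n)%N ->
  n%:R ^+ k / expR (n%:R * c) <= k.+1`!%:R / c ^+ k.+1 * n%:R^-1.
Proof.
move=> c0 n0; have N0 : 0 < n%:R :> R by rewrite ltr0n.
have f0 : 0 < k.+1`!%:R :> R by rewrite ltr0n fact_gt0.
have nc0 : 0 <= n%:R * c by rewrite mulr_ge0 // ltW.
(* The single Taylor term of degree [k + 1] is enough to gain the factor [1/n]. *)
have h : (n%:R * c) ^+ k.+1 / k.+1`!%:R <= expR (n%:R * c).
  by apply: le_trans (expR_ge1Dxn k nc0); rewrite lerDr.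
rewrite ler_pdivrMr ?expR_gt0 //.
apply: le_trans (ler_wpM2l _ h); last first.
  by rewrite !mulr_ge0 ?invr_ge0 ?exprn_ge0 // ltW.
have ck0 : 0 < c ^+ k.+1 by rewrite exprn_gt0.
rewrite exprMn (exprS n%:R k) le_eqVlt; apply/orP; left; apply/eqP.
move: (c ^+ k.+1) (n%:R ^+ k) ck0 => ck nk ck0.
by field; rewrite !gt_eqF.
Qed.

Lemma mu_bound_cvg {R : realType} : mu_bound R n @[n --> \oo] --> (0 : R).
Proof.
have l20 : 0 < ln 2 :> R by rewrite ln_gt0 // ltr1n.
have c0 : 0 < 3^-1 * ln 2 :> R by rewrite mulr_gt0 // invr_gt0.
(* After [ln n <= n], the two numerators are of order [n^4] and [n^3]; [D] collects the constants of
   [inv_expR_lin_le] for these degrees. *)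
pose D : R := 3 * expR 1 * (5`!%:R / (3^-1 * ln 2) ^+ 5) +
  expR 1 * (4`!%:R / ln 2 ^+ 4).
have e0 := @expR_ge0 R 1.
have D0 : 0 <= D.
  by rewrite addr_ge0 // !mulr_ge0 ?invr_ge0 ?exprn_ge0 // ltW.
apply: (@squeeze_cvgr _ _ _ _ (fun=> 0) (fun n => 2 * D * harmonic n)).
- near=> n; rewrite mu_bound_ge0 /=.
  have n0 : (0 < n)%N by near: n; exists 1%N.
  have N0 : 0 < n%:R :> R by rewrite ltr0n.
  have lnge0 : 0 <= ln n%:R :> R by apply: ln_ge0; rewrite ler1n.
  have lnle : ln n%:R <= n%:R :> R by rewrite ltW // ln_sublinear.
  (* [harmonic n] is [1/(n + 1)], hence the factor 2 in [1/n <= 2/(n + 1)]. *)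
  apply: (@le_trans _ _ (D * n%:R^-1)); last first.
    rewrite -mulrA mulrCA ler_wpM2l // /harmonic /=.
    rewrite ler_pdivlMr ?ltr0Sn // ler_pdivrMl //.
    by rewrite -natr1; have : 1 <= n%:R :> R by [rewrite ler1n]; lra.
  have p1 : n%:R * ln n%:R ^+ 3 <= n%:R ^+ 4 :> R.
    by rewrite (exprS _ 3) ler_wpM2l ?(ltW N0) // lerXn2r ?nnegrE // ltW.
  have p2 : n%:R ^+ 2 * ln n%:R <= n%:R ^+ 3 :> R.
    by rewrite (exprSr _ 2) ler_wpM2l ?exprn_ge0.
  have q1 := @inv_expR_lin_le R _ 4 n c0 n0.
  have q2 := @inv_expR_lin_le R _ 3 n l20 n0.
  rewrite /mu_bound [leRHS]mulrDl; apply: lerD.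
  + have -> : 2 `^ (n%:R / 3) = expR (n%:R * (3^-1 * ln 2)) :> R.
      by rewrite /powR pnatr_eq0 /= mulrA.
    rewrite -!(mulrA (3 * expR 1)) ler_wpM2l ?mulr_ge0 //.
    apply: le_trans q1; rewrite ler_wpM2r ?invr_ge0 ?expR_ge0 //.
  + have -> : 2 ^+ n = expR (n%:R * ln 2) :> R by rewrite expRM_natl lnK ?posrE.
    rewrite -!(mulrA (expR 1)) ler_wpM2l //.
    by apply: le_trans q2; rewrite ler_wpM2r ?invr_ge0 ?expR_ge0.
- exact: cvg_cst.
- rewrite -[X in _ --> X](mulr0 (2 * D)).
  by apply: cvgM; [exact: cvg_cst|exact: cvg_harmonic].
Unshelve. all: by end_near. Qed.

Theorem theorem2 (R : realType) :
  (forall n : nat, (4 <= n)%N ->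
     lebesgue_const R n <=
       (7 + mu_bound R n) * (2 ^+ n.+1 / (expR 1 * n%:R * (ln n%:R - ln 2)))
       * (1 + 15 / (n%:R - 3))) /\
  (mu_bound R n @[n --> \oo] --> (0 : R)).
Proof.
split; last exact: mu_bound_cvg.
move=> n n4; apply: ge_sup.
  (* Bounding a supremum by an upper bound asks for a nonempty set; a vertex of the triangle
     provides a value. *)
  exists (lebesgue_fun n (1, 0, 0)), (1, 0, 0) => //.
  by rewrite /simplex /= !addr0; do !split.
by move=> _ [l sl <-]; apply: lebesgue_fun_bound.
Qed.
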